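(* Let $I$ be a Borel ideal on $2^\omega$ with a $\Pi^1_2$ definition. Suppose there is a Borel function $f:2^\omega\to2^\omega$ and distinct points $x_\alpha\in 2^\omega$, $\alpha<\omega_2$, with $f^{-1}[\{x_\alpha\}]\notin I$ for each $\alpha$. Then there is a nonempty perfect set $P\subseteq 2^\omega$ such that $f^{-1}[\{x\}]\notin I$ for all $x\in P$. Consequently $I$ has property (M).
   Context: Ideals are assumed to contain all singletons and not to contain the whole space. A Borel ideal $I$ on $2^\omega$ has a $\Pi^1_2$ definition if there is a $\Pi^1_2$ formula $\Phi(x)$ such that $\Phi(a)$ holds iff $a$ is a Borel code and the set coded by $a$ belongs to $I$. Property (M): there is a Borel function $g:2^\omega\to2^\omega$ with $g^{-1}[\{x\}]\notin I$ for all $x$. *)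

(* Defs.v *)
From HB Require Import structures.
From mathcomp Require Import all_boot all_order all_algebra.
From mathcomp Require Import all_classical all_reals all_analysis.
Set Implicit Arguments. Unset Strict Implicit. Unset Printing Implicit Defensive.
Local Open Scope classical_set_scope.

Definition Borel (B : set cantor_space) : Prop := <<s @open cantor_space >> B.

Definition BorelFun (f : cantor_space -> cantor_space) : Prop :=
  forall U : set cantor_space, open U -> Borel (f @^-1` U).

Definition ideal (I : set (set cantor_space)) : Prop :=
  [/\ (forall A B, I B -> A `<=` B -> I A),
      (forall A B, I A -> I B -> I (A `|` B)),
      (forall x, I [set x]) & ~ I setT].

Definition BorelIdeal (I : set (set cantor_space)) : Prop :=
  ideal I /\ forall A, I A -> exists B, [/\ Borel B, A `<=` B & I B].

(** Borel codes.  A fixed standard coding of Borel sets by reals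
    a in 2^omega.  pairn i n = 2^i(2n+1) - 1 is a bijection nat*nat -> nat,
    and (sub a i) is the i-th section of a. *)
Definition pairn (i n : nat) : nat := (2 ^ i * n.*2.+1).-1.
Definition sub (a : cantor_space) (i : nat) : cantor_space := fun n => a (pairn i n).

Inductive codes : cantor_space -> set cantor_space -> Prop :=
| code_open (a : cantor_space) :
    a (pairn 0 0) = false ->
    codes a [set x | exists n (s : seq bool),
               [/\ a (pairn 1 n) = true, unpickle n = Some s & mkseq x (size s) = s]]
| code_compl (a : cantor_space) (B : set cantor_space) :
    a (pairn 0 0) = true -> a (pairn 0 1) = false ->
    codes (sub a 1) B -> codes a (~` B)
| code_union (a : cantor_space) (Bs : nat -> set cantor_space) :
    a (pairn 0 0) = true -> a (pairn 0 1) = true ->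
    (forall i, codes (sub a i.+1) (Bs i)) -> codes a (\bigcup_i Bs i).

(** Boldface Pi^1_2 subsets of 2^omega in normal form:
    a in A  <->  forall y in omega^omega, exists z in omega^omega,
                 forall n, R (a|n) (y|n) (z|n). *)
Definition Pi12 (A : set cantor_space) : Prop :=
  exists R : seq bool -> seq nat -> seq nat -> Prop,
    forall a : cantor_space, A a <->
      forall y : nat -> nat, exists z : nat -> nat,
        forall n, R (mkseq a n) (mkseq y n) (mkseq z n).

Definition HasPi12Def (I : set (set cantor_space)) : Prop :=
  exists Phi : set cantor_space, Pi12 Phi /\
    forall a, Phi a <-> exists B, codes a B /\ I B.

Definition PropertyM (I : set (set cantor_space)) : Prop :=
  exists g : cantor_space -> cantor_space,
    BorelFun g /\ forall x, ~ I (g @^-1` [set x]).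

Definition WellOrder (W : Type) (lt : W -> W -> Prop) : Prop :=
  [/\ (forall w, ~ lt w w),
      (forall u v w, lt u v -> lt v w -> lt u w),
      (forall u v, [\/ lt u v, u = v | lt v u]) &
      well_founded lt].

Definition CountableT (T : Type) : Prop := exists f : T -> nat, injective f.

Definition Omega1Like (W : Type) (lt : W -> W -> Prop) : Prop :=
  [/\ WellOrder lt, ~ CountableT W &
      forall w, CountableT {v : W | lt v w}].

(* order type omega_2: well-order of cardinality > aleph_1 all of whose proper
   initial segments have cardinality <= aleph_1 *)
Definition Omega2Like (W : Type) (lt : W -> W -> Prop) : Prop :=
  [/\ WellOrder lt,
      (forall (V : Type) (ltV : V -> V -> Prop), Omega1Like ltV ->
          ~ exists f : W -> V, injective f) &
      (forall w, exists (V : Type) (ltV : V -> V -> Prop)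
          (f : {v : W | lt v w} -> V), Omega1Like ltV /\ injective f)].

(* Main.v *)
(** The set of y whose fibre f^-1{y} is not in I is the complement of a Pi12 set,
    because a code of f^-1{y} can be computed continuously from y.  A point lies
    in such a complement iff, for some witness, the associated tree on omega is
    well-founded, hence carries a rank function into a countable initial segment
    of omega_1.  Fixing the bound v < omega_1 of the ranks, the pairs (witness,
    rank function) form a closed relation, so the set is a union of aleph_1
    analytic sets.  With omega_2 many points one of these is uncountable, and
    the Cantor scheme of its uncountable sections embeds 2^omega into it by some
    phi.  A Borel left inverse of phi composed with f gives property (M). *)
Require Import Defs.
From HB Require Import structures.
From mathcomp Require Import all_boot all_order all_algebra.
From mathcomp Require Import all_classical all_reals all_analysis.
Local Open Scope classical_set_scope.
Set Implicit Arguments. Unset Strict Implicit. Unset Printing Implicit Defensive.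

(** * Cantor space *)

Definition agree {T : Type} (n : nat) (x y : nat -> T) : Prop :=
  forall i, (i < n)%N -> x i = y i.

Lemma agree_sym T n (x y : nat -> T) : agree n x y -> agree n y x.
Proof. by move=> h i /h. Qed.

Lemma agree_trans T n (x y z : nat -> T) :
  agree n x y -> agree n y z -> agree n x z.
Proof. by move=> h1 h2 i lin; rewrite h1 // h2. Qed.

Lemma agree_le T m n (x y : nat -> T) :
  (m <= n)%N -> agree n x y -> agree m x y.
Proof. by move=> lemn h i /leq_trans/(_ lemn)/h. Qed.

Lemma mkseq_agree T n (x y : nat -> T) : mkseq x n = mkseq y n <-> agree n x y.
Proof.
split=> [e i lin|h]; last first.
  by apply: (@eq_from_nth _ (x 0)); rewrite ?size_mkseq // => i lin;
    rewrite !nth_mkseq // h.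
by have := congr1 (fun s => nth (x 0) s i) e; rewrite !nth_mkseq.
Qed.

Lemma neq_agree T (x y : nat -> T) : x <> y -> exists n, ~ agree n x y.
Proof.
move=> xy; apply/not_existsP => h; apply: xy; apply/funext => i.
by have /contrapT/(_ i) := h i.+1; apply.
Qed.

(** Input and output lengths are equal, so finite approximations can be pulled back without shifting
    [n]. *)
Definition Lipschitz1 (phi : cantor_space -> cantor_space) : Prop :=
  forall n x y, agree n x y -> agree n (phi x) (phi y).

Lemma nbhs_cantorP (x : cantor_space) (U : set cantor_space) :
  nbhs x U <-> exists n, forall y, agree n x y -> U y.
Proof.
split.
  pose F := filter_from setT (fun n => [set y : cantor_space | agree n x y]).
  have FF : Filter F.
    apply: filter_from_filter; first by exists 0.
    move=> i j _ _; exists (maxn i j) => // y h; split.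
      exact: agree_le (leq_maxl _ _) h.
    exact: agree_le (leq_maxr _ _) h.
  suff /(_ U) Fx : F --> x by move=> /Fx [n _ h]; exists n => y /h.
  apply/cvg_sup => i A [B [[C oC <-] Bx] sBA].
  exists i.+1 => // y /= h; apply: sBA => /=.
  by rewrite -(h i).
move=> [n h]; apply: filterS h _.
elim: n => [|n IH]; first exact: filterS filterT.
have xn : nbhs x [set y : cantor_space | y n = x n].
  have := @proj_continuous nat (fun _ => bool) n x.
  move=> /(_ [set x n]); apply.
  by apply: open_nbhs_nbhs; split => //; exact: discrete_open.
apply: filterS (filterI IH xn) => y /= [h yn] i.
by rewrite ltnS leq_eqVlt => /orP[/eqP->//|/h].
Qed.

Lemma Lipschitz1_continuous phi : Lipschitz1 phi -> continuous phi.
Proof.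
move=> phiL x U /nbhs_cantorP[n h]; apply/nbhs_cantorP; exists n => y xy.
exact/h/phiL.
Qed.

(** * Images of injective Lipschitz maps *)

Section LipschitzInjection.
Variable phi : cantor_space -> cantor_space.
Hypothesis phiL : Lipschitz1 phi.
Hypothesis phi_inj : injective phi.

Lemma closed_image_Lipschitz1 (C : set cantor_space) :
  closed C -> closed (phi @` C).
Proof.
move=> cC; apply: compact_closed; first exact: cantor_space_hausdorff.
apply: continuous_compact.
  by apply: continuous_subspaceT => ?; exact: Lipschitz1_continuous.
exact: (subclosed_compact cC cantor_space_compact (@subsetT _ _)).
Qed.

Lemma perfect_range_Lipschitz1 : perfect_set (range phi).
Proof.
apply/perfectP; split; first exact/closed_image_Lipschitz1/closedT.
rewrite -subset0 => y [/set_mem[b _ <-] [U /nbhs_cantorP[n h] Ub]].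
(* Flipping bit [n] keeps the image in the given neighbourhood but changes it, by injectivity. *)
pose b' : cantor_space := fun i => if i == n then ~~ b i else b i.
have : phi b' = phi b.
  suff : (U `&` range phi) (phi b') by rewrite Ub.
  split; last by exists b'.
  apply/h/phiL => i lin; rewrite /b'.
  by case: eqP => // e; rewrite e ltnn in lin.
by move=> /phi_inj/(congr1 (@^~ n)); rewrite /b' eqxx; case: (b n).
Qed.

End LipschitzInjection.

(** * Borel sets and Borel left inverses *)

Lemma sigma_algebra_Borel : sigma_algebra setT Borel.
Proof. exact: smallest_sigma_algebra. Qed.

Lemma BorelC A : Borel A -> Borel (~` A).
Proof. by have [_ h _] := sigma_algebra_Borel => /h; rewrite setTD. Qed.

Lemma Borel_bigcup (F : nat -> set cantor_space) :
  (forall n, Borel (F n)) -> Borel (\bigcup_n F n).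
Proof. by have [_ _ h] := sigma_algebra_Borel => /h. Qed.

Lemma BorelI A B : Borel A -> Borel B -> Borel (A `&` B).
Proof.
move=> bA bB; rewrite -[A `&` B]setCK; apply: BorelC.
rewrite setCI -bigcup2E; apply: Borel_bigcup => -[|[|n]] /=; try exact: BorelC.
by have [] := sigma_algebra_Borel.
Qed.

(* Off the range of phi the left inverse takes the constant value [cst false],
   so the preimage of an open set U is the complement of the closed set
   phi[~U] when U contains that value, and its trace on range phi otherwise. *)
Lemma Borel_left_inverse phi f : Lipschitz1 phi -> injective phi -> BorelFun f ->
  exists h, cancel phi h /\ BorelFun (h \o f).
Proof.
move=> phiL phi_inj fB.
have /choice[h hP] (y : cantor_space) : exists b : cantor_space,
    phi b = y \/ (~ range phi y /\ b = (fun _ => false)).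
  have [[b _ <-]|ny] := pselect (range phi y); first by exists b; left.
  by exists (fun _ => false); right.
have hK : cancel phi h.
  move=> b; have [/phi_inj//|[[]]] := hP (phi b); by exists b.
exists h; split=> // U oU.
have fBc (C : set cantor_space) : closed C -> Borel (f @^-1` C).
  move=> cC; rewrite -[_ @^-1` _]setCK preimage_setC; apply: BorelC; apply: fB.
  exact: closed_openC.
pose D := phi @` (~` U).
have cD : closed D by apply: closed_image_Lipschitz1 => //; exact: open_closedC.
have cR : closed (range phi) by apply: closed_image_Lipschitz1 => //; exact: closedT.
have [U0|U0] := pselect (U (fun _ => false)).
  have -> : (h \o f) @^-1` U = ~` (f @^-1` D); last by apply: BorelC; exact: fBc.
  apply/seteqP; split => x /=.
    by move=> Uh [b nU e]; apply: nU; move: Uh; rewrite -e hK.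
  move=> nD; apply: contrapT => nU; have [e|[_ e]] := hP (f x).
    by apply: nD; exists (h (f x)).
  by apply: nU; rewrite e.
have -> : (h \o f) @^-1` U = f @^-1` range phi `&` ~` (f @^-1` D).
  apply/seteqP; split => x /=.
    move=> Uh; split; last by move=> [b nU e]; apply: nU; move: Uh; rewrite -e hK.
    have [e|[_ e]] := hP (f x); first by exists (h (f x)).
    by move: Uh; rewrite e.
  move=> [[b _ e] nD]; rewrite -e hK; apply: contrapT => nU.
  by apply: nD; exists b.
by apply: BorelI; [exact: fBc|apply: BorelC; exact: fBc].
Qed.

(** * The perfect set theorem for projections of closed relations *)

(** Closedness in the product topology, with [K] discrete. *)
Definition closed_rel (K : Type)
    (E : cantor_space -> (nat -> K) -> Prop) : Prop :=
  forall x y, (forall n, exists x' y', [/\ E x' y', agree n x x' & agree n y y']) ->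
    E x y.

Section PerfectSet.
Variables (K : countType) (E : cantor_space -> (nat -> K) -> Prop).
Hypothesis Ecl : closed_rel E.

(** The projection of [E] cut down to the box of depth [n] around [(x, y)]. Infinite sequences stand
    for finite ones: only their first [n] values matter. *)
Definition section (n : nat) (x : cantor_space) (y : nat -> K) :
    set cantor_space :=
  [set x' | agree n x x' /\ exists2 y', agree n y y' & E x' y'].

Definition big_node (p : nat * (cantor_space * (nat -> K))) : Prop :=
  ~ countable (section p.1 p.2.1 p.2.2).

(** The children disagree in the first coordinate, so that branches stay apart after projection. *)
Definition splits (p q0 q1 : nat * (cantor_space * (nat -> K))) : Prop :=
  [/\ (p.1 < q0.1)%N, q1.1 = q0.1, ~ agree q0.1 q0.2.1 q1.2.1 &
      forall q, q = q0 \/ q = q1 ->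
        agree p.1 p.2.1 q.2.1 /\ agree p.1 p.2.2 q.2.2].

(** A box is given by two finite sequences over countable types, so there are only countably many
    small boxes. *)
Lemma countable_small_sections : countable [set x | exists n y,
  E x y /\ countable (section n x y)].
Proof.
pose S (c : seq bool * seq K) := [set x : cantor_space |
  exists2 y, E x y & mkseq x (size c.1) = c.1 /\ mkseq y (size c.1) = c.2].
apply: (@sub_countable _ _ _ (\bigcup_(c in [set c | countable (S c)]) S c)).
  apply: subset_card_le => x [n [y [Exy cs]]].
  exists (mkseq x n, mkseq y n) => /=; last by exists y; rewrite ?size_mkseq.
  apply: sub_countable cs; apply: subset_card_le => x' [y' Exy'] /=.
  rewrite size_mkseq => -[/mkseq_agree xx' /mkseq_agree yy'].
  by split; [exact: agree_sym|exists y' => //; exact: agree_sym].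
by apply: bigcup_countable => //; exact: countableP.
Qed.

(** An uncountable section has two distinct points outside the countable set [small]. Every box
    around a pair of [E] above such a point is big. *)
Lemma big_node_splits p : big_node p ->
  exists q0 q1, [/\ big_node q0, big_node q1 & splits p q0 q1].
Proof.
case: p => n [x y] /= bp.
set small := [set x | exists n y, E x y /\ countable (section n x y)].
pose G := section n x y `\` small.
have [[x0 [x1 [Gx0 Gx1 x01]]]|G1] :=
    pselect (exists x0 x1, [/\ G x0, G x1 & x0 <> x1]); last first.
  exfalso; apply: bp; rewrite /=.
  have cG : countable G.
    apply/countable_injP; exists (fun=> 0) => u v /set_mem Gu /set_mem Gv _.
    by apply: contrapT => uv; apply: G1; exists u, v.
  apply: (@sub_countable _ _ _ (\bigcup_(b in [set: bool]) if b then G else small)).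
    apply: subset_card_le => u su.
    have [us|us] := pselect (small u); first by exists false.
    by exists true.
  by apply: bigcup_countable => // -[] _ //; exact: countable_small_sections.
have [[xx0 [y0 yy0 E0]] ns0] := Gx0.
have [[xx1 [y1 yy1 E1]] ns1] := Gx1.
have [m nag] := neq_agree x01.
pose k := maxn n.+1 m.
exists (k, (x0, y0)), (k, (x1, y1)); split.
- by move=> ck; apply: ns0; exists k, y0.
- by move=> ck; apply: ns1; exists k, y1.
- split=> //=; first exact: leq_maxl.
    by move=> /(agree_le (leq_maxr _ _)).
  by move=> q [->|->].
Qed.

Theorem perfect_set_projection : ~ countable [set x | exists y, E x y] ->
  exists phi : cantor_space -> cantor_space,
    [/\ injective phi, Lipschitz1 phi & forall b, exists y, E (phi b) y].
Proof.
move=> unc.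
pose node := {p | big_node p}.
have [y00] : exists y : nat -> K, True.
  apply: contrapT => ny; apply: unc.
  rewrite (_ : [set x | _] = set0) // -subset0 => x [y _].
  by apply: ny; exists y.
move=> _; have root : node.
  exists (0, ((fun=> false), y00)) => /= cs; apply: unc.
  apply: sub_countable cs; apply: subset_card_le => x [y Exy].
  by split=> //; exists y.
have /choice[spl splP] (p : node) :
    exists q : node * node, splits (sval p) (sval q.1) (sval q.2).
  have [q0 [q1 [b0 b1 h]]] := big_node_splits (svalP p).
  by exists (exist _ q0 b0, exist _ q1 b1).
pose child p (c : bool) := if c then (spl p).2 else (spl p).1.
pose fix st (b : cantor_space) k : node :=
  if k is k'.+1 then child (st b k') (b k') else root.
pose dep b k := (sval (st b k)).1.
pose xs b k := (sval (st b k)).2.1.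
pose ys b k := (sval (st b k)).2.2.
have childP p c : [/\ ((sval p).1 < (sval (child p c)).1)%N,
    agree (sval p).1 (sval p).2.1 (sval (child p c)).2.1 &
    agree (sval p).1 (sval p).2.2 (sval (child p c)).2.2].
  have [lt e _ ag] := splP p; rewrite /child; case: c.
    by have [? ?] := ag _ (or_intror erefl); rewrite e.
  by have [? ?] := ag _ (or_introl erefl).
have dep_ge b k : (k <= dep b k)%N.
  elim: k => // k IH; have [lt _ _] := childP (st b k) (b k).
  exact: leq_ltn_trans IH lt.
have dep_mono b j k : (j <= k)%N -> (dep b j <= dep b k)%N.
  elim: k => [|k IH]; first by rewrite leqn0 => /eqP->.
  rewrite leq_eqVlt => /orP[/eqP->//|/IH le].
  have [lt _ _] := childP (st b k) (b k).
  exact: leq_trans le (ltnW lt).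
have mono b j k : (j <= k)%N ->
    agree (dep b j) (xs b j) (xs b k) /\ agree (dep b j) (ys b j) (ys b k).
  elim: k => [|k IH]; first by rewrite leqn0 => /eqP->.
  rewrite leq_eqVlt => /orP[/eqP->//|le].
  have [ax ay] := IH le; have [_ bx by_] := childP (st b k) (b k).
  split.
    exact: agree_trans ax (agree_le (dep_mono b j k le) bx).
  exact: agree_trans ay (agree_le (dep_mono b j k le) by_).
(* Diagonal limit: stage [i.+1] has depth greater than [i], so its coordinate [i] is final. *)
pose phi b : cantor_space := fun i => xs b i.+1 i.
pose psi b : nat -> K := fun i => ys b i.+1 i.
have limP b k : agree (dep b k) (xs b k) (phi b) /\ agree (dep b k) (ys b k) (psi b).
  have lt i : (i < dep b i.+1)%N by exact: dep_ge b i.+1.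
  split=> i li; rewrite /phi /psi; have [ki|ik] := leqP k i.+1.
  - by have [h _] := mono b _ _ ki; rewrite h.
  - by have [h _] := mono b _ _ (ltnW ik); rewrite h.
  - by have [_ h] := mono b _ _ ki; rewrite h.
  - by have [_ h] := mono b _ _ (ltnW ik); rewrite h.
have st_agree b b' k : agree k b b' -> st b k = st b' k.
  elim: k => //= k IH h; rewrite IH; last exact: agree_le h.
  by rewrite h.
exists phi; split.
- move=> b b' e; apply/funext => i; suff /(_ i.+1 i) : forall k, agree k b b' by apply.
  elim=> // k IH j; rewrite ltnS leq_eqVlt => /orP[/eqP->{j}|/IH//].
  (* The limits agree with the two children of the common node up to their common depth, where the
     children differ. *)
  have diverge u v : st u k = st v k -> phi u = phi v ->
      u k = false -> v k = true -> False.
    move=> est ephi uk vk.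
    have [_ e10 nag _] := splP (st u k); apply: nag.
    have := (limP u k.+1).1; have := (limP v k.+1).1.
    rewrite /dep /xs /= -est uk vk /child ephi => h h'.
    by apply: agree_trans h' _; apply: agree_sym; rewrite -e10.
  have est := st_agree _ _ _ IH.
  case ub: (b k); case vb: (b' k) => //; exfalso.
    exact: (diverge b' b).
  exact: (diverge b b').
- move=> n b b' /st_agree e.
  apply: (agree_le (dep_ge b n)).
  apply: agree_trans (agree_sym (limP b n).1) _.
  by rewrite /xs /dep e; exact: (limP b' n).1.
(* Big nodes have nonempty sections, so [E] meets boxes shrinking to [(phi b, psi b)], and [Ecl]
   applies. *)
- move=> b; exists (psi b); apply: Ecl => n.
  have [x' [xx' [y' yy' Exy]]] : section (dep b n) (xs b n) (ys b n) !=set0.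
    apply/set0P/eqP => s0; apply: (svalP (st b n)).
    by rewrite -/(dep b n) -/(xs b n) -/(ys b n) s0.
  exists x', y'; split=> //; apply: (agree_le (dep_ge b n)).
    exact: agree_trans (agree_sym (limP b n).1) xx'.
  exact: agree_trans (agree_sym (limP b n).2) yy'.
Qed.
End PerfectSet.

(** * omega_1 and ranks of well-founded trees *)

Lemma CountableT_sig T (A : set T) : CountableT {v | A v} <-> countable A.
Proof.
split=> [[f finj]|/countable_injP[f finj]]; last first.
  exists (f \o sval) => -[u Au] [v Av] /= /finj e.
  by apply/eq_exist/e; exact/mem_set.
apply/countable_injP.
exists (fun v => if pselect (A v) is left h then f (exist _ v h) else 0).
move=> u v /set_mem Au /set_mem Av.
by case: pselect => // hu; case: pselect => // hv /finj[].
Qed.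

Lemma CountableT_setT T : CountableT T <-> countable [set: T].
Proof.
split=> [[f finj]|/countable_injP[f finj]].
  by apply/countable_injP; exists f => u v _ _ /finj.
by exists f => u v; apply: finj; exact/mem_set.
Qed.

Lemma cantor_space_uncountable : ~ countable [set: cantor_space].
Proof.
move=> /countable_injP[f finj].
pose b : cantor_space := fun n => ~~ `[< exists2 x : cantor_space, f x = n & x n >].
have [t|/negP t] := boolP (b (f b)).
  by move: (t) => /negP; apply; apply/asboolP; exists b.
apply: t; apply/negP => /asboolP[x /finj xb].
by rewrite xb; [move=> /[dup] t /negP; apply; apply/asboolP; exists b
  | exact/mem_set | exact/mem_set].
Qed.

Lemma WellOrder_sig T (lt : T -> T -> Prop) (A : set T) : WellOrder lt ->
  WellOrder (fun u v : {v | A v} => lt (sval u) (sval v)).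
Proof.
move=> [irr tr tot wf]; split.
- by move=> w; exact: irr.
- by move=> u v w; exact: tr.
- move=> [u Au] [v Av] /=; have [h|h|h] := tot u v.
  + exact: Or31.
  + by apply: Or32; exact: eq_exist.
  + exact: Or33.
- move=> [u Au]; elim/(well_founded_ind wf): u Au => u IH Au.
  by constructor => -[v Av] /= /IH.
Qed.

(** The well-ordering principle gives every nonempty set a unique least element. Sets of at most
    three points yield the laws of a linear order, whose strict part is taken. *)
Lemma WellOrder_exists (T : eqType) : exists lt : T -> T -> Prop, WellOrder lt.
Proof.
have [R Rwo] := wochoice.well_ordering_principle T.
have minP (A : set T) u : A u -> exists2 z, A z & forall v, A v -> R z v.
  move=> Au; have [|z [[Az zmin] _]] := Rwo (mem A); first by exists u; exact/mem_set.
  exists z => [|v Av]; first exact: set_mem.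
  by apply: zmin; exact/mem_set.
have Rrefl u : R u u by have [z -> h] := minP [set u] u erefl; exact: h.
have Ranti u v : R u v -> R v u -> u = v.
  move=> uv vu; pose A : set T := [set w | w = u \/ w = v].
  have [|z [_ zu]] := Rwo (mem A); first by exists u; apply/mem_set; left.
  rewrite -(zu u) ?(zu v) //; split.
  - by apply/mem_set; right.
  - by move=> w /set_mem[->|->].
  - by apply/mem_set; left.
  - by move=> w /set_mem[->|->].
have Rtot u v : R u v \/ R v u.
  have [z [->|->] h] := minP [set w | w = u \/ w = v] u (or_introl erefl).
    by left; apply: h; right.
  by right; apply: h; left.
have Rtrans u v w : R u v -> R v w -> R u w.
  move=> uv vw.
  have [z zA h] := minP [set t | [\/ t = u, t = v | t = w]] u (Or31 _ _ erefl).
  have hu : R z u by apply: h; exact: Or31.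
  have hv : R z v by apply: h; exact: Or32.
  have hw : R z w by apply: h; exact: Or33.
  case: zA => e; rewrite e in hu hv hw => //.
    by rewrite (Ranti u v).
  by rewrite (Ranti v w) // in uv.
exists (fun u v => u <> v /\ R u v); split.
- by move=> w [].
- move=> u v w [uv Ruv] [vw Rvw]; split; last exact: Rtrans Rvw.
  by move=> e; apply: uv; apply: Ranti; rewrite // e.
- move=> u v; have [->|uv] := pselect (u = v); first exact: Or32.
  have [h|h] := Rtot u v; first exact: Or31.
  by apply: Or33; split=> // e; apply: uv.
- move=> u; apply: contrapT => nu.
  have [z nz zmin] := minP [set w | ~ Acc (fun u v => u <> v /\ R u v) w] u nu.
  apply: nz; constructor => v [vz Rvz]; apply: contrapT => /zmin Rzv.
  by apply: vz; exact: Ranti.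
Qed.

Lemma well_founded_min T (lt : T -> T -> Prop) (A : set T) u :
  well_founded lt -> A u -> exists2 z, A z & forall v, lt v z -> ~ A v.
Proof.
move=> wf; elim/(well_founded_ind wf): u => u IH Au.
have [[v vu Av]|h] := pselect (exists2 v, lt v u & A v); first exact: IH vu Av.
by exists u => // v vu Av; apply: h; exists v.
Qed.

(* omega_1 is the set of points of a well-ordered continuum
   whose initial segment is countable *)
Lemma Omega1Like_exists : exists (V : Type) (lt : V -> V -> Prop), Omega1Like lt.
Proof.
have [lt ltW] := WellOrder_exists cantor_space.
pose A : set cantor_space := [set v | countable [set u | lt u v]].
exists {v | A v}, (fun u v => lt (sval u) (sval v)); split.
- exact: WellOrder_sig.
- move=> /CountableT_sig cA; apply: cantor_space_uncountable.
  (* If [A] is countable it is everything: a least point outside would have its initial segment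
     inside [A], hence countable. *)
  rewrite (_ : setT = A) //; apply/seteqP; split=> // v _; apply: contrapT => nv.
  have [_ _ _ wf] := ltW.
  have [z nz zmin] := @well_founded_min _ lt (~` A) v wf nv.
  apply: nz; apply: sub_countable cA; apply: subset_card_le => u /= uz.
  exact: contrapT (zmin _ uz).
- move=> [w Aw]; apply/CountableT_sig; have /countable_injP[f finj] := Aw.
  apply/countable_injP; exists (f \o sval) => -[u Au] [v Av] /=.
  move=> /set_mem /= uw /set_mem /= vw /finj e; apply: eq_exist; apply: e; exact/mem_set.
Qed.

(** This order makes [V * nat] an [Omega1Like] type, a target for counting the points of aleph_1
    many countable sets. *)
Definition lex_nat V (lt : V -> V -> Prop) (p q : V * nat) : Prop :=
  lt p.1 q.1 \/ (p.1 = q.1 /\ (p.2 < q.2)%N).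

Lemma Omega1Like_lex_nat V (lt : V -> V -> Prop) :
  Omega1Like lt -> Omega1Like (lex_nat lt).
Proof.
move=> [[irr tr tot wf] unc cnt]; split; first split.
- by move=> [v n] [/irr//|[_ /=]]; rewrite ltnn.
- move=> [u i] [v j] [w k] /= [uv|[/= -> ij]] [vw|[/= <- jk]].
  + by left; exact: tr vw.
  + by left.
  + by left.
  + by right; split=> //=; exact: ltn_trans jk.
- move=> [u i] [v j]; have [h|->|h] := tot u v.
  + by apply: Or31; left.
  + have [h|h|->] := ltngtP i j.
    * by apply: Or31; right.
    * by apply: Or33; right.
    * exact: Or32.
  + by apply: Or33; left.
- move=> [v n]; elim/(well_founded_ind wf): v n => v IHv n.
  elim/ltn_ind: n => n IHn; constructor => -[u i] /= [uv|[/= -> lin]].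
    exact: IHv.
  exact: IHn.
- move=> [f finj]; apply: unc; exists (fun v => f (v, 0)) => u v /finj.
  by case.
- move=> [w n]; apply/CountableT_sig.
  apply: (@sub_countable _ _ _ (([set v | lt v w] `|` [set w]) `*` [set: nat])).
    by apply: subset_card_le => -[v i] /= [?|[/= -> _]]; split=> //; [left|right].
  apply: countableX => //; rewrite -bigcup2E; apply: bigcup_countable => //.
  by move=> [|[|i]] _ //=; apply/CountableT_sig; exact: cnt.
Qed.

(** Regularity of omega_1: without a bound, [V] would be a countable union of countable initial
    segments. *)
Lemma Omega1Like_bounded V (lt : V -> V -> Prop) (u : nat -> V) :
  Omega1Like lt -> exists v, forall n, lt (u n) v.
Proof.
move=> [[irr tr tot wf] unc cnt]; apply: contrapT => nb; apply: unc.
apply/CountableT_setT.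
apply: (@sub_countable _ _ _ (\bigcup_n ([set v | lt v (u n)] `|` [set u n]))).
  apply: subset_card_le => v _; apply: contrapT => nv; apply: nb; exists v => n.
  have [//|e|h] := tot (u n) v; exfalso; apply: nv; exists n => //.
    by right.
  by left.
apply: bigcup_countable => // n _; rewrite -bigcup2E.
by apply: bigcup_countable => // -[|[|i]] _ //=; apply/CountableT_sig; exact: cnt.
Qed.

(** * Rank functions on trees without branches *)

(** The extension relation inside the tree is well founded. Recursion along it takes a strict upper
    bound of the ranks of the countably many children. *)
Lemma tree_rank V (lt : V -> V -> Prop) (T : set (seq nat)) : Omega1Like lt ->
  (forall s k, T (rcons s k) -> T s) ->
  ~ (exists z, forall n, T (mkseq z n)) ->
  exists rho : seq nat -> V,
    forall s k, T (rcons s k) -> lt (rho (rcons s k)) (rho s).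
Proof.
move=> O1 Tpre nbr.
pose r (t s : seq nat) := (exists k, t = rcons s k) /\ T t.
(* An inaccessible root would allow choosing inaccessible children forever, which is a branch. *)
have acc_nil : Acc r [::].
  apply: contrapT => nacc; apply: nbr.
  have /choice[nxt nxtP] (s : seq nat) : exists k,
      ~ Acc r s -> T (rcons s k) /\ ~ Acc r (rcons s k).
    have [h|ns] := pselect (Acc r s); first by exists 0.
    apply: contrapT => h; apply: ns; constructor => _ [[k ->] Tk].
    by apply: contrapT => nk; apply: h; exists k.
  pose fix st n := if n is m.+1 then rcons (st m) (nxt (st m)) else [::].
  have stE n : st n = mkseq (nxt \o st) n.
    by elim: n => //= n {1}->; rewrite /mkseq -addn1 iotaD map_cat /= cats1.
  have stacc n : ~ Acc r (st n) by elim: n => //= n /nxtP[].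
  exists (nxt \o st) => n; rewrite -stE.
  by have [/Tpre] := nxtP _ (stacc n).
have wf : well_founded r.
  elim/last_ind => [//|s k IH].
  have [Tk|nT] := pselect (T (rcons s k)); first by apply: (Acc_inv IH); split => //; exists k.
  by constructor => _ [[j ->] /Tpre].
have /choice[sup supP] (u : nat -> V) : exists v, forall n, lt (u n) v.
  exact: Omega1Like_bounded.
have [v0 _] : exists v : V, True.
  have [_ unc _] := O1; apply: contrapT => nv; apply: unc.
  by exists (fun=> 0) => u; exfalso; apply: nv; exists u.
pose F s (rec : forall t, r t s -> V) : V := sup (fun k =>
  if pselect (r (rcons s k) s) is left h then rec _ h else v0).
have FE s g h : (forall t (p : r t s), g t p = h t p) -> F s g = F s h.
  move=> gh; rewrite /F; congr (sup _); apply/funext => k.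
  by case: pselect => // p; rewrite gh.
exists (Fix wf (fun=> V) F) => s k Tk.
rewrite [X in lt _ X](Fix_eq _ _ _ FE) /F.
set u := (X in sup X); have := supP u k; rewrite {1}/u.
by case: pselect => // -[]; split=> //; exists k.
Qed.

(** * Complements of Pi12 sets *)

Lemma mkseq_take T (x : nat -> T) m n : (m <= n)%N -> take m (mkseq x n) = mkseq x m.
Proof. by move=> le; rewrite /mkseq -map_take take_iota (minn_idPl le). Qed.

Section Pi12Complement.
Variable R : seq bool -> seq nat -> seq nat -> Prop.

(** Testing all truncations makes this a tree, whose branches are the witnesses [z] for [x] and
    [y]. *)
Definition Rtree (x : cantor_space) (y : nat -> nat) : set (seq nat) :=
  [set s | forall m, (m <= size s)%N -> R (mkseq x m) (mkseq y m) (take m s)].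

Lemma Rtree_branch x y z :
  (forall n, Rtree x y (mkseq z n)) <->
  (forall n, R (mkseq x n) (mkseq y n) (mkseq z n)).
Proof.
split=> h n; last by move=> m; rewrite size_mkseq => le; rewrite mkseq_take.
by have := h n n; rewrite size_mkseq mkseq_take //; apply.
Qed.

Lemma Rtree_rcons x y s k : Rtree x y (rcons s k) -> Rtree x y s.
Proof.
move=> h m le; have := h m; rewrite size_rcons => /(_ (leqW le)).
by rewrite -cats1 takel_cat.
Qed.

Lemma Rtree_agree x y x' y' s : agree (size s) x x' -> agree (size s) y y' ->
  Rtree x y s -> Rtree x' y' s.
Proof.
move=> ax ay h m le; have := h m le.
by rewrite (mkseq_agree m x x').2 ?(mkseq_agree m y y').2 //; exact: agree_le le _.
Qed.

(* The second coordinates of [w], read along [pickle], are a rank function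
   on the tree given by the first coordinates. *)
Definition ranked_by (L : nat -> nat -> Prop) (x : cantor_space)
    (w : nat -> nat * nat) : Prop :=
  forall s k, Rtree x (fst \o w) (rcons s k) ->
    L (w (pickle (rcons s k))).2 (w (pickle s)).2.

Lemma closed_rel_ranked_by L : closed_rel (ranked_by L).
Proof.
move=> x w h s k Tk.
(* This depth covers the digits read by the tree and the two positions holding ranks. *)
pose n := maxn (size (rcons s k)) (maxn (pickle (rcons s k)).+1 (pickle s).+1).
have [x' [w' [Ew' ax aw]]] := h n.
have le1 : (size (rcons s k) <= n)%N by exact: leq_maxl.
have le2 : (pickle (rcons s k) < n)%N.
  by apply: leq_trans (leq_maxr _ _); exact: leq_maxl.
have le3 : (pickle s < n)%N.
  by apply: leq_trans (leq_maxr _ _); exact: leq_maxr.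
rewrite aw // aw //; apply: Ew'; apply: Rtree_agree Tk.
  exact: agree_le ax.
by move=> i lt /=; rewrite aw //; exact: leq_trans le1.
Qed.

Variables (V : Type) (lt : V -> V -> Prop).
Hypothesis O1 : Omega1Like lt.

(** The order below [v] transported to numbers, so that rank functions become sequences over a
    countable type, as the perfect set theorem requires. *)
Definition coded_lt (v : V) (e : V -> nat) (i j : nat) : Prop :=
  exists a b, [/\ lt a v, lt b v, e a = i, e b = j & lt a b].

Lemma ranked_by_no_branch v e x w : {in [set a | lt a v] &, injective e} ->
  ranked_by (coded_lt v e) x w ->
  ~ exists z, forall n, R (mkseq x n) (mkseq (fst \o w) n) (mkseq z n).
Proof.
move=> einj rk [z /Rtree_branch br].
pose rho n := (w (pickle (mkseq z n))).2.
have step n : coded_lt v e (rho n.+1) (rho n).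
  rewrite /rho; have := br n.+1.
  rewrite {1 2}/mkseq -addn1 iotaD map_cat /= cats1 => /rk.
  by [].
(* Induction on [a]: the term after [e a] codes a point below [a], so ranks along a branch would
   descend forever. *)
have nope a : lt a v -> forall n, rho n <> e a.
  have [[_ _ _ wf] _ _] := O1.
  elim/(well_founded_ind wf): a => a IH av n en.
  have [a' [b' [a'v b'v ea' eb' a'b']]] := step n.
  have bE : b' = a by apply: einj; rewrite ?eb' //; exact/mem_set.
  by apply: (IH a' _ a'v n.+1); rewrite -?bE.
by have [a [b [_ bv _ /esym eb _]]] := step 0; exact: nope bv _ eb.
Qed.

Lemma ranked_by_exists x y (e : V -> V -> nat) :
  ~ (exists z, forall n, R (mkseq x n) (mkseq y n) (mkseq z n)) ->
  exists v w, ranked_by (coded_lt v (e v)) x w.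
Proof.
move=> nbr.
have [||rho rhoP] := @tree_rank V lt (Rtree x y) O1.
- by move=> s k; exact: Rtree_rcons.
- by move=> [z /Rtree_branch br]; apply: nbr; exists z.
have [v vP] := @Omega1Like_bounded V lt (rho \o odflt [::] \o unpickle) O1.
have {}vP s : lt (rho s) v by have := vP (pickle s); rewrite /comp pickleK.
(* The common bound [v] of all ranks selects the coding. The default [[::]] only serves numbers that
   are not codes. *)
exists v, (fun n => (y n, e v (rho (odflt [::] (unpickle n))))) => s k /rhoP h.
by cbn [snd]; rewrite !pickleK; exists (rho (rcons s k)), (rho s).
Qed.

End Pi12Complement.

(** * Perfect subsets of complements of Pi12 sets *)

Theorem Sigma12_perfect (A : set cantor_space) W (ltW : W -> W -> Prop)
    (x : W -> cantor_space) :
  Pi12 A -> Omega2Like ltW -> injective x -> (forall w, ~ A (x w)) ->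
  exists phi : cantor_space -> cantor_space,
    [/\ injective phi, Lipschitz1 phi & forall b, ~ A (phi b)].
Proof.
move=> [R RA] [_ O2 _] xinj nAx.
have [V [lt O1]] := Omega1Like_exists.
have /choice[e einj] (v : V) : exists e : V -> nat, {in [set a | lt a v] &, injective e}.
  by have [_ _ /(_ v)/CountableT_sig/countable_injP] := O1.
pose E v := ranked_by R (coded_lt lt v (e v)).
have EA v u w : E v u w -> ~ A u.
  move=> Euw /RA/(_ (fst \o w)).
  exact: (ranked_by_no_branch O1 (einj v) Euw).
have /choice[vw vwP] (w : W) : exists v, exists c, E v (x w) c.
  have [y nbr] : exists y, ~ exists z, forall n,
      R (mkseq (x w) n) (mkseq y n) (mkseq z n).
    by apply: contrapT => h; apply: (nAx w); apply/RA => y; apply: contrapT => nz;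
      apply: h; exists y.
  exact: (ranked_by_exists O1 e nbr).
(* Every projection avoids [A], so one uncountable projection suffices. *)
have [[v unc]|cnt] := pselect (exists v, ~ countable [set u | exists c, E v u c]).
  have [phi [phi_inj phiL phiE]] :=
    perfect_set_projection (@closed_rel_ranked_by R _) unc.
  exists phi; split=> // b; have [c] := phiE b; exact: EA.
have /choice[g ginj] (v : V) : exists g : cantor_space -> nat,
    {in [set u | exists c, E v u c] &, injective g}.
  apply/countable_injP; apply: contrapT => h; apply: cnt; by exists v.
(* Otherwise [x w] is determined by its bound and its number in that projection, which injects [W]
   into [V * nat]. *)
exfalso; apply: (O2 _ _ (Omega1Like_lex_nat O1)).
exists (fun w => (vw w, g (vw w) (x w))) => u w [evw eg].
apply: xinj; apply: (ginj (vw u)); last by rewrite eg evw.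
  exact/mem_set/vwP.
by rewrite evw; exact/mem_set/vwP.
Qed.

(** * Borel codes *)

Definition unpairn (m : nat) : nat * nat :=
  (logn 2 m.+1, (m.+1 %/ 2 ^ logn 2 m.+1)./2).

Lemma pairnK i n : unpairn (pairn i n) = (i, n).
Proof.
have gt0 : (0 < 2 ^ i * n.*2.+1)%N by rewrite muln_gt0 expn_gt0.
have L : logn 2 (2 ^ i * n.*2.+1) = i.
  rewrite lognM ?expn_gt0 // pfactorK // lognE /= dvdn2 /= odd_double.
  by rewrite addn0.
rewrite /unpairn /pairn prednK // L mulKn ?expn_gt0 //.
by rewrite -[n.*2.+1]/(true + n.*2)%N half_bit_double.
Qed.

(** These bounds make digit [m] of a [join] depend only on parts and digits of index at most [m]. *)
Lemma unpairn1_le m : ((unpairn m).1 <= m)%N.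
Proof. by rewrite -ltnS; exact: ltn_logl. Qed.

Lemma unpairn2_le m : ((unpairn m).2 <= m)%N.
Proof.
rewrite /= -ltnS; apply: (@leq_ltn_trans m.+1./2).
  by apply: half_leq; exact: leq_div.
by rewrite -divn2; exact: ltn_Pdiv.
Qed.

Definition join (d : nat -> cantor_space) : cantor_space :=
  fun m => d (unpairn m).1 (unpairn m).2.

Lemma joinE d i n : join d (pairn i n) = d i n.
Proof. by rewrite /join pairnK. Qed.

Lemma sub_join d i : sub (join d) i = d i.
Proof. by apply/funext => n; exact: joinE. Qed.

(** The digits at [pairn 0 0] and [pairn 0 1] determine the constructor. Hence the existential in
    [HasPi12Def] speaks of a single set. *)
Lemma codes_inj a B B' : codes a B -> codes a B' -> B = B'.
Proof.
move=> cB; elim: cB B' => {a B}.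
- by move=> a a0 B' cB'; inversion cB' => //; congruence.
- move=> a B a0 a1 _ IH B' cB'; inversion cB'; try congruence.
  by rewrite (IH _ H1).
- move=> a Bs a0 a1 _ IH B' cB'; inversion cB'; try congruence.
  by congr bigcup; apply/funext => i; exact: IH.
Qed.

(** The test [n == 0] writes the digits true, false that mark a complement. *)
Definition compl_code (a : cantor_space) : cantor_space :=
  join (fun i n => match i with 0 => n == 0 | 1 => a n | _ => false end).

Definition union_code (d : nat -> cantor_space) : cantor_space :=
  join (fun i n => if i is j.+1 then d j n else true).

Lemma codes_compl_code a B : codes a B -> codes (compl_code a) (~` B).
Proof. by move=> cB; apply: code_compl; rewrite ?joinE // sub_join. Qed.

Lemma codes_union_code d Bs : (forall i, codes (d i) (Bs i)) ->
  codes (union_code d) (\bigcup_i Bs i).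
Proof. by move=> cB; apply: code_union => [||i]; rewrite ?joinE // sub_join. Qed.

Lemma open_codes U : open U -> exists a, codes a U.
Proof.
move=> oU; pose inU n := `[< exists2 s, unpickle n = Some s &
  forall x : cantor_space, mkseq x (size s) = s -> U x >].
pose a : cantor_space := join (fun i n => (i == 1) && inU n).
have aE n : a (pairn 1 n) = inU n by rewrite /a joinE.
exists a; suff -> : U = [set x | exists n (s : seq bool),
    [/\ a (pairn 1 n) = true, unpickle n = Some s & mkseq x (size s) = s]].
  by apply: code_open; rewrite /a joinE.
apply/seteqP; split=> x; last first.
  move=> [n [s [+ es xs]]]; rewrite aE => /asboolP[t].
  by rewrite es => -[<-]; apply.
move=> Ux; have /nbhs_cantorP[n h] : nbhs x U by exact: open_nbhs_nbhs.
exists (pickle (mkseq x n)), (mkseq x n); rewrite aE size_mkseq pickleK; split=> //.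
apply/asboolP; exists (mkseq x n); first exact: pickleK.
move=> y; rewrite size_mkseq => /mkseq_agree xy.
by apply: h; exact: agree_sym.
Qed.

Lemma Borel_codes B : Borel B -> exists a, codes a B.
Proof.
suff /(_ B) : Borel `<=` [set B | exists a, codes a B] by [].
apply: smallest_sub; last by move=> U /open_codes.
split.
- by apply: open_codes; exact: open0.
- by move=> A [a cA]; rewrite setTD; exists (compl_code a); exact: codes_compl_code.
- move=> F /choice[d dP]; exists (union_code d); exact: codes_union_code.
Qed.

(** The fibre is the complement of the union over [i] of the sets where [f] differs from [y] at [i].
    Codes for both bits at each [i] are fixed in advance, and [y] only selects among them. *)
Lemma fiber_code f : BorelFun f -> exists c, Lipschitz1 c /\
  forall y, codes (c y) (f @^-1` [set y]).
Proof.
move=> fB.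
have /choice[a aP] (ib : nat * bool) : exists a,
    codes a (f @^-1` [set z : cantor_space | z ib.1 = ib.2]).
  apply: Borel_codes; apply: fB; rewrite openE => z /= zi.
  apply/nbhs_cantorP; exists ib.1.+1 => y zy /=; by rewrite -zy.
exists (fun y => compl_code (union_code (fun i => a (i, ~~ y i)))); split.
  (* Digit [m] reads its argument at most at one index [j], with [j <= k <= m < n]. *)
  move=> n x y xy m mn; rewrite /compl_code /join.
  case: (unpairn m).1 => // -[|//]; rewrite /union_code /join.
  set k := (unpairn m).2; have kn : (k < n)%N.
    exact: leq_ltn_trans (unpairn2_le m) mn.
  have := unpairn1_le k; case: (unpairn k).1 => // j jk.
  by rewrite xy //; exact: ltn_trans kn.
move=> y; suff -> : f @^-1` [set y] = ~` \bigcup_i f @^-1` [set z : cantor_space | z i = ~~ y i].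
  apply: codes_compl_code; apply: codes_union_code => i; exact: (aP (i, ~~ y i)).
apply/seteqP; split=> x /=.
  by move=> fx [i _]; rewrite /preimage /= fx; case: (y i).
move=> h; apply/funext => i; apply: contrapT => ne; apply: h; exists i => //=.
by case: (f x i) (y i) ne => -[].
Qed.

Lemma Pi12_preimage A c : Lipschitz1 c -> Pi12 A -> Pi12 (c @^-1` A).
Proof.
move=> cL [R RA].
(* Padding with [false] is harmless: the first [n] digits of [c a] need only [n] digits of [a]. *)
exists (fun s => R (mkseq (c (nth false s)) (size s))) => a.
have E n : mkseq (c (nth false (mkseq a n))) (size (mkseq a n)) = mkseq (c a) n.
  rewrite size_mkseq; apply/mkseq_agree; apply: cL => i lin.
  by rewrite nth_mkseq.
split=> [/RA h y|h]; last apply/RA => y; have [z hz] := h y; exists z => n.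
  by rewrite E.
by have := hz n; rewrite E.
Qed.

(** * The perfect set of fibres and property (M) *)

Theorem theorem4p5 (I : set (set cantor_space))
    (f : cantor_space -> cantor_space)
    (W : Type) (ltW : W -> W -> Prop) (x : W -> cantor_space) :
  BorelIdeal I -> HasPi12Def I -> BorelFun f ->
  Omega2Like ltW -> injective x ->
  (forall al : W, ~ I (f @^-1` [set x al])) ->
  (exists P : set cantor_space,
      [/\ P !=set0, perfect_set P & forall y, P y -> ~ I (f @^-1` [set y])])
  /\ PropertyM I.
Proof.
move=> [[Isub _ _ _] _] [Phi [PhiPi PhiI]] fB O2 xinj nI.
have [c [cL cP]] := fiber_code fB.
have PhiE y : (c @^-1` Phi) y <-> I (f @^-1` [set y]).
  split=> [/PhiI[B [cB IB]]|IB].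
    by rewrite (codes_inj (cP y) cB).
  by apply/PhiI; exists (f @^-1` [set y]).
have [|phi [phi_inj phiL phiP]] :=
  Sigma12_perfect (Pi12_preimage cL PhiPi) O2 xinj.
  by move=> w /PhiE; exact: nI.
have nIphi b : ~ I (f @^-1` [set phi b]) by move=> /PhiE; exact: phiP.
split.
  exists (range phi); split.
  - by exists (phi (fun=> false)); exists (fun=> false).
  - exact: perfect_range_Lipschitz1.
  - by move=> _ [b _ <-].
have [h [hK hB]] := Borel_left_inverse phiL phi_inj fB.
(* The fibre of [h \o f] over [b] contains that of [f] over [phi b], and [I] is closed under
   subsets. *)
exists (h \o f); split=> // b Ib; apply: (nIphi b); apply: Isub Ib _.
by move=> u /= ->.
Qed.
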